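(* Let $\mu,\nu\in\mathcal{P}([0,1])$ be absolutely continuous with respect to the Lebesgue measure, with density functions $\rho_\mu$ and $\rho_\nu$ and cumulative distribution functions $F_\mu$ and $F_\nu$. For all $N\in\mathbb{N}^*$, let $$I^N=\inf\left\{\int_{[0,1]^2}|x-y|\,d\pi(x,y)\;:\;\pi\in\Pi(\mu,\nu;(\psi^N_m)_{1\le m\le N},(\psi^N_n)_{1\le n\le N})\right\}.$$ There exists a minimizer for this problem. Assume in addition that the function $F_\mu-F_\nu$ changes sign at most $Q$ times for some $Q\in\mathbb{N}$, and that $\rho_\mu-\rho_\nu\in L^\infty([0,1],dx;\mathbb{R})$. Then $$I^N\le W_1(\mu,\nu)\le I^N+2\|\rho_\mu-\rho_\nu\|_\infty\frac{Q}{N^2}.$$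
   Context: $\mathbb{N}^*=\{1,2,\dots\}$. For $N\in\mathbb{N}^*$, $T^N_1=[0,\frac1N]$ and $T^N_m=(\frac{m-1}{N},\frac mN]$ for $2\le m\le N$. $\mathcal{P}(E)$ is the set of Borel probability measures on $E$. The test functions on $[0,1]$ are: $\psi^N_1(x)=1-Nx$ if $x\in T^N_1$ and $\psi^N_1(x)=0$ elsewhere; for $2\le m\le N$, $\psi^N_m(x)=N\left(x-\frac{m-2}{N}\right)$ if $x\in T^N_{m-1}$, $\psi^N_m(x)=1-N\left(x-\frac{m-1}{N}\right)$ if $x\in T^N_m$, and $\psi^N_m(x)=0$ elsewhere. $\Pi(\mu,\nu;(\psi^N_m)_{1\le m\le N},(\psi^N_n)_{1\le n\le N})$ is the set of $\pi\in\mathcal{P}([0,1]^2)$ such that for all $1\le m,n\le N$, $\int\psi^N_m(x)\,d\pi(x,y)=\int\psi^N_m\,d\mu$ and $\int\psi^N_n(y)\,d\pi(x,y)=\int\psi^N_n\,d\nu$. ''$F_\mu-F_\nu$ changes sign at most $Q$ times'' means: with $G:=F_\mu-F_\nu$, there exist $x_0=0<x_1<x_2<\dots<x_Q<x_{Q+1}=1$ such that for all $1\le q\le Q+1$ and all $x,y\in[x_{q-1},x_q]$, $G(x)G(y)\ge0$, and for all $1\le q\le Q$, all $x\in[x_{q-1},x_q]$ and $z\in[x_q,x_{q+1}]$, $G(x)G(z)\le0$. $W_1(\mu,\nu)=\inf\int|x-y|\,d\pi(x,y)$ over probability measures $\pi$ on $[0,1]^2$ with marginals $\mu$ and $\nu$.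 *)

(* Defs.v *)
From HB Require Import structures.
From mathcomp Require Import all_boot all_order all_algebra.
From mathcomp Require Import all_classical all_reals all_analysis.

Set Implicit Arguments.
Unset Strict Implicit.
Unset Printing Implicit Defensive.
Import Order.TTheory GRing.Theory Num.Theory.
Import numFieldNormedType.Exports.

Local Open Scope classical_set_scope.
Local Open Scope ring_scope.

(** A Borel probability measure on [0,1] (resp. [0,1]^2) is represented by a
    Borel probability measure on R (resp. R * R) that gives mass 1 to [0,1]
    (resp. [0,1]^2). *)

Definition unit_itv (R : realType) : set (measurableTypeR R) := `[0, 1].
Arguments unit_itv : clear implicits.

Definition unit_square (R : realType) :
    set (measurableTypeR R * measurableTypeR R) :=
  unit_itv R `*` unit_itv R.
Arguments unit_square : clear implicits.

Lemma measurable_unit_itv (R : realType) : measurable (unit_itv R).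
Proof. exact: measurable_itv. Qed.

(** The measure dx of L^oo([0,1], dx; R). *)
Definition lebesgue01 (R : realType) :
    {measure set (measurableTypeR R) -> \bar R} :=
  mrestr lebesgue_measure (@measurable_unit_itv R).
Arguments lebesgue01 : clear implicits.

(** [rho] is only looked at on [0,1]; its nonnegativity almost everywhere is a
    consequence of the formula, as [mu] is nonnegative. *)
Definition is_density (R : realType) (mu : probability (measurableTypeR R) R)
    (rho : measurableTypeR R -> R) : Prop :=
  (lebesgue_measure).-integrable (unit_itv R) (EFin \o rho) /\
  forall A : set (measurableTypeR R), measurable A -> A `<=` unit_itv R ->
    mu A = (\int[lebesgue_measure]_(x in A) (rho x)%:E)%E.

Definition cdf_of (R : realType) (mu : probability (measurableTypeR R) R)
    (x : R) : R :=
  fine (mu `]-oo, x]%classic).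

Definition changes_sign_at_most (R : realType) (Q : nat) (G : R -> R) : Prop :=
  exists x : nat -> R,
    [/\ x 0%N = 0, x Q.+1 = 1,
        forall q, (q <= Q)%N -> x q < x q.+1,
        forall q, (1 <= q <= Q.+1)%N ->
          forall y z, x q.-1 <= y <= x q -> x q.-1 <= z <= x q ->
          0 <= G y * G z
      & forall q, (1 <= q <= Q)%N ->
          forall y z, x q.-1 <= y <= x q -> x q <= z <= x q.+1 ->
          G y * G z <= 0].

Definition cell (R : realType) (N m : nat) : set R :=
  if m == 1%N then `[0, 1 / N%:R]%classic
  else `](m%:R - 1) / N%:R, m%:R / N%:R]%classic.

(** Indices run over [1 <= m <= N]; [psi N 0] is a junk value. *)
Definition psi (R : realType) (N m : nat) (x : R) : R :=
  if m == 1%N then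
    if x \in cell N 1 then 1 - N%:R * x else 0
  else
    if x \in cell N m.-1 then N%:R * (x - (m%:R - 2) / N%:R)
    else if x \in cell N m then 1 - N%:R * (x - (m%:R - 1) / N%:R)
    else 0.

Definition moment_couplings (R : realType)
    (mu nu : probability (measurableTypeR R) R)
    (M : nat) (f : nat -> R -> R) (N : nat) (g : nat -> R -> R) :
    set (probability (measurableTypeR R * measurableTypeR R)%type R) :=
  [set pi | [/\ pi (unit_square R) = 1%E,
      forall m, (1 <= m <= M)%N ->
        (\int[pi]_(z in unit_square R) (f m z.1)%:E
         = \int[mu]_(x in unit_itv R) (f m x)%:E)%E
    & forall n, (1 <= n <= N)%N ->
        (\int[pi]_(z in unit_square R) (g n z.2)%:E
         = \int[nu]_(y in unit_itv R) (g n y)%:E)%E]].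

Definition couplings (R : realType)
    (mu nu : probability (measurableTypeR R) R) :
    set (probability (measurableTypeR R * measurableTypeR R)%type R) :=
  [set pi | [/\ pi (unit_square R) = 1%E,
      forall A, measurable A -> pushforward pi fst A = mu A
    & forall B, measurable B -> pushforward pi snd B = nu B]].

Definition transport_cost (R : realType)
    (pi : probability (measurableTypeR R * measurableTypeR R)%type R) :
    \bar R :=
  (\int[pi]_(z in unit_square R) `|z.1 - z.2|%:E)%E.

Definition W1 (R : realType) (mu nu : probability (measurableTypeR R) R) :
    \bar R :=
  ereal_inf [set transport_cost pi | pi in couplings mu nu].

Definition moment_problem (R : realType)
    (mu nu : probability (measurableTypeR R) R) (N : nat) :
    set (probability (measurableTypeR R * measurableTypeR R)%type R) :=
  moment_couplings mu nu N (psi N) N (psi N).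

Definition I_ (R : realType) (mu nu : probability (measurableTypeR R) R)
    (N : nat) : \bar R :=
  ereal_inf [set transport_cost pi | pi in moment_problem mu nu N].

(* Main.v *)
(** Idea. On [0,1] the functions [psi N 1], ..., [psi N N] and the constant 1
    span the same space as 1 and the ramps r_k, where r_k(x) is N x - k clamped
    to [0,1].  The ramps satisfy |x - y| = 1/N sum_k |r_k(x) - r_k(y)|, so every
    admissible pi costs at least V = 1/N sum_k |p_k - q_k|, with p_k and q_k the
    integrals of r_k against mu and nu.  V is attained by the law of (X, Y),
    where X(u) = 1/N #{k | u < p_k}, Y(u) = 1/N #{k | u < q_k} and u is uniform
    on [0,1], because r_k(X(u)) is the indicator of u < p_k.  Hence I^N = V.

    For the upper bound on W_1, let now X and Y be the quantile functions of mu
    and nu.  On a cell where G = F_mu - F_nu has constant sign, r_k(X) - r_k(Y)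
    has constant sign too, so its L^1 norm is |p_k - q_k|.  Any other cell has
    some x_q in its interior; there |G| <= ||rho_mu - rho_nu||_oo / N because
    G(x_q) = 0, and by Tonelli this bounds the L^1 norm.  There are at most Q
    such cells. *)

Require Import Defs.
From HB Require Import structures.
From mathcomp Require Import all_boot all_order all_algebra.
From mathcomp Require Import all_classical all_reals all_analysis.
From mathcomp Require Import measurable_realfun ess_sup_inf ring lra.
Import Order.TTheory GRing.Theory Num.Theory.
Import numFieldNormedType.Exports.
Local Open Scope classical_set_scope.
Local Open Scope ring_scope.

Set Implicit Arguments.
Unset Strict Implicit.
Unset Printing Implicit Defensive.

(** * Ramps *)

Section ramp.
Context {R : realType}.
Implicit Types (N k : nat) (x y : R).

Definition ramp N k x : R := Num.min (Num.max (N%:R * x - k%:R) 0) 1.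

(** The ranges overlap at their endpoints, so every case offers weak linear inequalities and an
    affine value; later facts about ramps reduce to [lra]. *)
Lemma rampP N k x :
  [\/ N%:R * x <= k%:R /\ ramp N k x = 0,
      k%:R <= N%:R * x <= k.+1%:R /\ ramp N k x = N%:R * x - k%:R
    | k.+1%:R <= N%:R * x /\ ramp N k x = 1].
Proof.
rewrite /ramp -natr1 -/(Num.max _ _).
have [h|h] := leP (N%:R * x - k%:R) 0.
  by apply: Or31; rewrite min_l//; split=> //; lra.
have [h1|h1] := leP (N%:R * x - k%:R) 1.
  by apply: Or32; split => //; lra.
by apply: Or33; split => //; lra.
Qed.

Lemma ramp_itv N k x : 0 <= ramp N k x <= 1.
Proof. by case: (rampP N k x); rewrite -?natr1 => -[h ->]; lra. Qed.

Lemma ramp_ge0 N k x : 0 <= ramp N k x.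
Proof. by case/andP: (ramp_itv N k x). Qed.

Lemma le_ramp N k : {homo ramp N k : x y / x <= y}.
Proof.
move=> x y xy; have : N%:R * x <= N%:R * y by rewrite ler_wpM2l.
by case: (rampP N k x); case: (rampP N k y); rewrite -?natr1 => -[h ->] -[h' ->]; lra.
Qed.

Lemma ramp_anti N k k' x : (k <= k')%N -> ramp N k' x <= ramp N k x.
Proof.
rewrite -(ler_nat R) => kk'.
case: (rampP N k x); case: (rampP N k' x); rewrite -?natr1 => -[h ->] -[h' ->]; lra.
Qed.

Lemma measurable_ramp N k : measurable_fun setT (ramp N k).
Proof.
apply: measurable_minr => //; apply: measurable_maxr => //.
by apply: measurable_funB => //; exact: measurable_funM.
Qed.

(** The sign condition matters: at negative [x] the left side is 0 and the right side is 1. *)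
Lemma psi_ramp1 N x : (0 < N)%N -> 0 <= x -> psi N 1 x = 1 - ramp N 0 x.
Proof.
rewrite -(ltr_nat R) => N0 x0; rewrite /psi /cell /=.
have := mulr_ge0 (ltW N0) x0.
have [|] := boolP (x \in _); rewrite ?inE ?notin_setE /= in_itv/= x0/= ler_pdivlMr// mulrC.
  by case: (rampP N 0 x) => -[h ->]; lra.
by move/negP; rewrite -ltNge; case: (rampP N 0 x) => -[h ->]; lra.
Qed.

(** The hat [psi N k.+2] rises exactly where [ramp N k] does, and falls on the next cell, where
    [ramp N k.+1] rises. *)
Lemma psi_ramp N k x : (0 < N)%N -> 0 <= x ->
  psi N k.+2 x = ramp N k x - ramp N k.+1 x.
Proof.
rewrite -(ltr_nat R) => N0 x0; rewrite /psi /cell.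
have := mulr_ge0 (ltW N0) x0.
rewrite [_ == _]/= [k.+2.-1]/=.
have -> : (k.+2%:R - 1) / N%:R = k.+1%:R / N%:R :> R by rewrite -[k.+2%:R]natr1 addrK.
have -> : (k.+2%:R - 2) / N%:R = k%:R / N%:R :> R.
  by congr (_ / _); rewrite -[k.+2]addn2 natrD addrK.
have -> : (k.+1%:R - 1) / N%:R = k%:R / N%:R :> R by rewrite -natr1 addrK.
have xN a : N%:R * (x - a / N%:R) = N%:R * x - a by field; rewrite gt_eqF.
rewrite !xN => t0.
(* The first cell is closed at 0, so the strict lower bound is only tested when [k] is positive. *)
have e1 : (x \in if k.+1 == 1 then `[0, 1 / N%:R] else `]k%:R / N%:R, k.+1%:R / N%:R])%classic =
   ((0 < k)%N ==> (k%:R < N%:R * x)) && (N%:R * x <= k.+1%:R).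
  case: k => [|k] /=; rewrite mem_setE /= in_itv/=.
    by rewrite x0 ler_pdivlMr// mulrC.
  by rewrite ltr_pdivrMr// ler_pdivlMr// [x * _]mulrC.
have e2 : (x \in `]k.+1%:R / N%:R, k.+2%:R / N%:R]%classic) =
   (k.+1%:R < N%:R * x) && (N%:R * x <= k.+2%:R).
  by rewrite mem_setE /= in_itv/= ltr_pdivrMr// ler_pdivlMr// [x * _]mulrC.
rewrite {}e1 {}e2 -[k.+2%:R]natr1.
case: ifP => [/andP[h1 h2]|].
  have {}h1 : k%:R <= N%:R * x by case: k h1 h2 => [|k] //= /ltW.
  case: (rampP N k x); case: (rampP N k.+1 x); rewrite -?natr1 => -[h ->] -[h' ->];
    move: h1 h2 ; rewrite -?natr1; lra.
move=> /negP/negP; rewrite negb_and.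
rewrite negb_imply -leNgt -ltNge => /orP[/andP[k0 h]|h].
  rewrite ifF; last by apply/negbTE; rewrite negb_and -leNgt -natr1; apply/orP; left; lra.
  by case: (rampP N k x); case: (rampP N k.+1 x); rewrite -?natr1 => -[h1 ->] -[h2 ->]; lra.
rewrite h/=; case: ifPn; rewrite -?ltNge;
  by move: h; case: (rampP N k x); case: (rampP N k.+1 x); rewrite -?natr1 => -[h1 ->] -[h2 ->]; lra.
Qed.

Lemma sum_ramp N x : 0 <= x -> \sum_(k < N) ramp N k x = Num.min (N%:R * x) N%:R.
Proof.
move=> x0; have t0 : 0 <= N%:R * x by rewrite mulr_ge0.
(* The number [n] of ramps is separated from the slope [N], which stays fixed during the
   induction. *)
suff H n : \sum_(k < n) ramp N k x = Num.min (N%:R * x) n%:R by [].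
elim: n => [|n IH]; first by rewrite big_ord0 min_r.
rewrite big_ord_recr/= IH; case: (rampP N n x); rewrite -?natr1 => -[h ->].
- by rewrite addr0 !min_l //; lra.
- by rewrite (min_r (y := n%:R)) ?min_l; lra.
- by rewrite !min_r; lra.
Qed.

(** For [y <= x] all ramp differences are nonnegative, so the sum splits by [sum_ramp] into
    [N x - N y]; on [0,1] the cap at [N] is inactive. *)
Lemma normB_ramp N x y : (0 < N)%N -> 0 <= x <= 1 -> 0 <= y <= 1 ->
  `|x - y| = N%:R^-1 * \sum_(k < N) `|ramp N k x - ramp N k y|.
Proof.
move=> N0.
wlog yx : x y / y <= x => [H hx hy|hx hy].
  have [yx|/ltW yx] := leP y x; first exact: H.
  by rewrite distrC H//; under eq_bigr do rewrite distrC.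
have N0' : 0 < N%:R :> R by rewrite ltr0n.
rewrite ger0_norm ?subr_ge0//.
under eq_bigr do rewrite ger0_norm ?subr_ge0 ?le_ramp//.
case/andP: hx hy => x0 x1 /andP[y0 y1].
rewrite sumrB !sum_ramp// !min_l; first by field; rewrite gt_eqF.
  by rewrite ler_piMr// ltW.
by rewrite ler_piMr// ltW.
Qed.

End ramp.

(** * Integrals of bounded functions against a probability measure *)

Section bounded_integrals.
Context d {T : measurableType d} {R : realType} (m : probability T R).
Variables (D : set T) (mD : measurable D).
Implicit Types f g : T -> R.

Lemma integrable_le1 g : measurable_fun D g -> (forall x, D x -> `|g x| <= 1) ->
  m.-integrable D (EFin \o g).
Proof.
move=> mg g1; apply: measurable_bounded_integrable => //.
  by rewrite (le_lt_trans (probability_le1 m mD))// ltry.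
exists 1; split => // M M1 x Dx; exact/(le_trans (g1 _ Dx))/ltW.
Qed.

Lemma EFin_Rintegral g : measurable_fun D g -> (forall x, D x -> `|g x| <= 1) ->
  (\int[m]_(x in D) g x)%:E = (\int[m]_(x in D) (g x)%:E)%E.
Proof.
by move=> mg g1; rewrite fineK// integrable_fin_num//; exact: integrable_le1.
Qed.

Lemma Rintegral_normB f g :
  measurable_fun D f -> measurable_fun D g ->
  (forall x, D x -> 0 <= f x <= 1) -> (forall x, D x -> 0 <= g x <= 1) ->
  `|\int[m]_(x in D) f x - \int[m]_(x in D) g x| <= \int[m]_(x in D) `|f x - g x|.
Proof.
move=> mf mg hf hg.
have intf : m.-integrable D (EFin \o f).
  by apply: integrable_le1 => // x /hf/andP[? ?]; rewrite ger0_norm.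
have intg : m.-integrable D (EFin \o g).
  by apply: integrable_le1 => // x /hg/andP[? ?]; rewrite ger0_norm.
rewrite -RintegralB//; apply: le_normr_Rintegral => //.
apply: integrable_le1; first exact: measurable_funB.
by move=> x Dx; rewrite ler_norml; have := hf _ Dx; have := hg _ Dx; lra.
Qed.

(** The equality case of the triangle inequality: the integrand keeps one sign. It gives both the
    optimality of the minimizer and the exactness of the estimate on cells of constant sign. *)
Lemma Rintegral_normB_le f g :
  measurable_fun D f -> measurable_fun D g ->
  (forall x, D x -> 0 <= f x <= 1) -> (forall x, D x -> 0 <= g x <= 1) ->
  (forall x, D x -> f x <= g x) ->
  \int[m]_(x in D) `|f x - g x| = `|\int[m]_(x in D) f x - \int[m]_(x in D) g x|.
Proof.
move=> mf mg hf hg fg.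
have intf : m.-integrable D (EFin \o f).
  by apply: integrable_le1 => // x /hf/andP[? ?]; rewrite ger0_norm.
have intg : m.-integrable D (EFin \o g).
  by apply: integrable_le1 => // x /hg/andP[? ?]; rewrite ger0_norm.
rewrite distrC ger0_norm ?subr_ge0; last exact: le_Rintegral.
rewrite -RintegralB//; apply: eq_Rintegral => x /set_mem Dx.
by rewrite distrC ger0_norm ?subr_ge0 ?fg.
Qed.

End bounded_integrals.

(** * Hat moments in terms of ramp moments *)

Section ramp_moments.
Context d {T : measurableType d} {R : realType} (m : probability T R).
Variables (D : set T) (mD : measurable D) (mD1 : m D = 1%E).
Variables (f : T -> R) (mf : measurable_fun setT f).
Hypothesis f01 : forall x, D x -> 0 <= f x <= 1.

Lemma measurable_ramp_comp N k : measurable_fun D (fun x => ramp N k (f x)).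
Proof. by apply/measurable_funTS/measurableT_comp => //; exact: measurable_ramp. Qed.

Lemma norm_ramp_le1 N k (x : R) : `|ramp N k x| <= 1.
Proof. by rewrite ger0_norm ?ramp_ge0//; case/andP: (ramp_itv N k x). Qed.

Lemma psi1_moment N : (0 < N)%N ->
  (\int[m]_(x in D) (psi N 1 (f x))%:E)%E =
  (1 - \int[m]_(x in D) ramp N 0 (f x))%:E.
Proof.
move=> N0; under eq_integral.
  move=> x /set_mem Dx; rewrite psi_ramp1//; last by case/andP: (f01 Dx).
  over.
rewrite /= EFinB EFin_Rintegral//; first last.
- by move=> x _; exact: norm_ramp_le1.
- exact: measurable_ramp_comp.
under eq_integral do rewrite EFinB.
rewrite integralB_EFin//.
- by rewrite integral_cst// mul1e; congr (_ - _)%E; exact: mD1.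
- by apply: integrable_le1 => // x _; rewrite normr1.
- apply: integrable_le1 => //; first exact: measurable_ramp_comp.
  by move=> x _; exact: norm_ramp_le1.
Qed.

Lemma psi_moment N k : (0 < N)%N ->
  (\int[m]_(x in D) (psi N k.+2 (f x))%:E)%E =
  (\int[m]_(x in D) ramp N k (f x) - \int[m]_(x in D) ramp N k.+1 (f x))%:E.
Proof.
move=> N0; under eq_integral.
  move=> x /set_mem Dx; rewrite psi_ramp//; last by case/andP: (f01 Dx).
  over.
rewrite /= EFinB !EFin_Rintegral//; try by move=> x _; exact: norm_ramp_le1.
- under eq_integral do rewrite EFinB.
  by rewrite integralB_EFin//; apply: integrable_le1 => //;
    by [exact: measurable_ramp_comp|move=> x _; exact: norm_ramp_le1].
- exact: measurable_ramp_comp.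
- exact: measurable_ramp_comp.
Qed.

End ramp_moments.

(* The [psi]-moments and the [ramp]-moments are related by an invertible
   triangular linear map. *)
Lemma psi_momentsP {R : realType} d1 d2 (T1 : measurableType d1)
    (T2 : measurableType d2) (m1 : probability T1 R) (m2 : probability T2 R)
    (D1 : set T1) (D2 : set T2) (f1 : T1 -> R) (f2 : T2 -> R) (N : nat) :
  (0 < N)%N -> measurable D1 -> measurable D2 -> m1 D1 = 1%E -> m2 D2 = 1%E ->
  measurable_fun setT f1 -> measurable_fun setT f2 ->
  (forall x, D1 x -> 0 <= f1 x <= 1) -> (forall x, D2 x -> 0 <= f2 x <= 1) ->
  (forall n, (1 <= n <= N)%N ->
    (\int[m1]_(x in D1) (psi N n (f1 x))%:E = \int[m2]_(x in D2) (psi N n (f2 x))%:E)%E)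
  <->
  (forall k, (k < N)%N ->
    \int[m1]_(x in D1) ramp N k (f1 x) = \int[m2]_(x in D2) ramp N k (f2 x)).
Proof.
move=> N0 mD1 mD2 mD11 mD21 mf1 mf2 hf1 hf2; split=> H.
  elim=> [_|k IH kN].
    have := H 1%N; rewrite !psi1_moment// N0 => /(_ isT) [] /eqP.
    by rewrite (inj_eq (addrI _)) eqr_opp => /eqP.
  have := H k.+2; rewrite !psi_moment// kN => /(_ isT) [] /eqP.
  by rewrite IH 1?ltnW// (inj_eq (addrI _)) eqr_opp => /eqP.
case=> [//|[_|k kN]]; first by rewrite !psi1_moment// H.
by rewrite !psi_moment// !H// ltnW.
Qed.

Section cost.
Context {R : realType}.
Let RR := (measurableTypeR R * measurableTypeR R)%type.
Variable pi : probability RR R.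

Lemma measurable_unit_square : measurable (unit_square R).
Proof. by apply: measurableX; exact: measurable_unit_itv. Qed.

(** The identity [normB_ramp] holds pointwise on the square, so the cost of any probability splits
    exactly into one contribution per cell. *)
Lemma transport_cost_ramp N : (0 < N)%N ->
  transport_cost pi = (N%:R^-1 * \sum_(k < N)
    \int[pi]_(z in unit_square R) `|ramp N k z.1 - ramp N k z.2|)%:E.
Proof.
move=> N0; rewrite /transport_cost.
have mr (k : nat) : measurable_fun (unit_square R)
   (fun z : RR => `|ramp N k z.1 - ramp N k z.2|).
  apply: measurableT_comp => //; apply: measurable_funB;
  by apply/measurable_funTS/measurableT_comp => //; exact: measurable_ramp.
have r1 (k : nat) (z : RR) : `| `|ramp N k z.1 - ramp N k z.2| | <= 1.
  rewrite normr_id ler_norml.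
  by move: (ramp_itv N k z.1) (ramp_itv N k z.2); lra.
rewrite EFinM -sumEFin.
under [X in (_ * X)%E]eq_bigr do rewrite (EFin_Rintegral _ measurable_unit_square)//.
rewrite -ge0_integral_sum//; last 2 first.
- exact: measurable_unit_square.
- by move=> i; exact/measurable_EFinP.
rewrite -ge0_integralZl//; last 3 first.
- exact: measurable_unit_square.
- by apply: emeasurable_sum => i; exact/measurable_EFinP.
- by move=> z _; apply: sume_ge0 => i _; rewrite lee_fin.
apply: eq_integral => -[x y] /set_mem[/= + +].
rewrite /unit_itv /= !in_itv/= => x01 y01.
by rewrite (normB_ramp N0 x01 y01) EFinM sumEFin.
Qed.

End cost.

(** * The value of the moment problem *)

Section uniform_coupling.
Context {R : realType}.
Let RR := (measurableTypeR R * measurableTypeR R)%type.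

Definition unif01 : probability (measurableTypeR R) R := uniform_prob (@ltr01 R).

Lemma unif01E (A : set (measurableTypeR R)) : measurable A ->
  unif01 A = lebesgue_measure (A `&` `[0, 1]).
Proof.
move=> mA; have := @integral_uniform R 0 1 ltr01 (EFin \o \1_A).
rewrite integral_indic// setIT => ->//; last first.
- by move=> x; rewrite lee_fin.
- exact/measurable_EFinP/measurable_indic.
by rewrite subr0 invr1 mul1e integral_indic.
Qed.

Lemma unif01_le (p : R) : 0 <= p <= 1 -> unif01 `]-oo, p]%classic = p%:E.
Proof.
move=> /andP[p0 p1]; rewrite unif01E//.
have -> : `]-oo, p] `&` `[0, 1] = `[0, p]%classic :> set R.
  apply/seteqP; split=> x /=; rewrite !in_itv/=.
    by move=> [xp /andP[-> _]].
  by move=> /andP[-> xp]; rewrite xp (le_trans xp).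
by rewrite lebesgue_measure_itv/= lte_fin; case: ltgtP p0 => // [_|<-]; rewrite ?sube0.
Qed.

Lemma unif01_lt (p : R) : 0 <= p <= 1 -> unif01 `]-oo, p[%classic = p%:E.
Proof.
move=> /andP[p0 p1]; rewrite unif01E//.
have -> : `]-oo, p[ `&` `[0, 1] = `[0, p[%classic :> set R.
  apply/seteqP; split=> x /=; rewrite !in_itv/=.
    by move=> [xp /andP[-> _]].
  by move=> /andP[-> xp]; rewrite xp (le_trans (ltW xp)).
by rewrite lebesgue_measure_itv/= lte_fin; case: ltgtP p0 => // [_|<-]; rewrite ?sube0.
Qed.

Variables X Y : measurableTypeR R -> measurableTypeR R.
Hypotheses (mX : measurable_fun setT X) (mY : measurable_fun setT Y).
Hypotheses (X01 : forall u, 0 <= X u <= 1) (Y01 : forall u, 0 <= Y u <= 1).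

Let XY (u : measurableTypeR R) : RR := (X u, Y u).

Let mXY : measurable_fun setT XY.
Proof. exact/measurable_fun_pair. Qed.

(** The joint law of [X u] and [Y u] for one uniform [u]. The minimizer and the quantile coupling
    are both of this form. *)
Definition unif01_image : probability RR R :=
  distribution unif01 (mfun_Sub (mem_set mXY)).

Lemma unif01_imageE A : unif01_image A = unif01 (XY @^-1` A).
Proof. by []. Qed.

Lemma preimage_unit_square : XY @^-1` unit_square R = setT.
Proof.
apply/seteqP; split=> // u _; split => /=; rewrite /unit_itv /= in_itv/=.
- exact: X01.
- exact: Y01.
Qed.

Lemma unif01_image_unit_square : unif01_image (unit_square R) = 1%E.
Proof. by rewrite unif01_imageE preimage_unit_square; exact: probability_setT. Qed.

(** A change of variables; the right side runs over the whole line because [X] and [Y] take values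
    in [0,1], so that the preimage of the square is everything. *)
Lemma Rintegral_unif01_image (h : RR -> R) :
  measurable_fun (unit_square R) h ->
  (forall z, unit_square R z -> 0 <= h z) ->
  \int[unif01_image]_(z in unit_square R) h z = \int[unif01]_u h (X u, Y u).
Proof.
move=> mh h0; congr fine.
rewrite ge0_integral_pushforward//; last 3 first.
- exact: measurable_unit_square.
- exact/measurable_EFinP.
- by move=> z /set_mem zs; rewrite lee_fin h0.
by have -> : mfun_Sub (mem_set mXY) @^-1` unit_square R = setT
  := preimage_unit_square.
Qed.

End uniform_coupling.


(** * Lower bound on the cost from the ramp moments *)

Section moment_value.
Context {R : realType}.
Let RR := (measurableTypeR R * measurableTypeR R)%type.
Variables mu nu : probability (measurableTypeR R) R.
Hypotheses (mu01 : mu (unit_itv R) = 1%E) (nu01 : nu (unit_itv R) = 1%E).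
Variable N : nat.
Hypothesis N0 : (0 < N)%N.

Definition ramp_moment (m : probability (measurableTypeR R) R) (k : nat) : R :=
  \int[m]_(x in unit_itv R) ramp N k x.

Definition moment_value : R :=
  N%:R^-1 * \sum_(k < N) `|ramp_moment mu k - ramp_moment nu k|.

Lemma ramp_moment_itv m k : 0 <= ramp_moment m k <= 1.
Proof.
have mI := @measurable_unit_itv R.
have mr : measurable_fun (unit_itv R) (ramp N k : R -> R).
  by apply: measurable_funTS; exact: measurable_ramp.
have ir : m.-integrable (unit_itv R) (EFin \o (ramp N k)).
  by apply: integrable_le1 => // x _; exact: norm_ramp_le1.
rewrite Rintegral_ge0/=; last by move=> x _; exact: ramp_ge0.
apply: (@le_trans _ _ (\int[m]_(x in unit_itv R) 1)).
  apply: le_Rintegral => //.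
    by apply: integrable_le1 => // x _; rewrite normr1.
  by move=> x _; case/andP: (ramp_itv N k x).
rewrite Rintegral_cst// mul1r -lee_fin fineK ?fin_num_measure//.
exact: probability_le1.
Qed.

(** This monotonicity makes the indices [k] with [u < ramp_moment m k] an initial segment, as
    [ramp_steps] requires. *)
Lemma ramp_moment_anti m k k' : (k <= k')%N -> ramp_moment m k' <= ramp_moment m k.
Proof.
move=> kk'; have mI := @measurable_unit_itv R.
have ir j : m.-integrable (unit_itv R) (EFin \o (ramp N j)).
  apply: integrable_le1 => // [|x _]; last exact: norm_ramp_le1.
  by apply: measurable_funTS; exact: measurable_ramp.
by apply: le_Rintegral => // x _; exact: ramp_anti.
Qed.

(** [psi_momentsP] is applied once per marginal, comparing a projection on the square with the
    identity on the interval. *)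
Lemma moment_problemP (pi : probability RR R) : pi (unit_square R) = 1%E ->
  moment_problem mu nu N pi <->
  (forall k, (k < N)%N ->
     \int[pi]_(z in unit_square R) ramp N k z.1 = ramp_moment mu k /\
     \int[pi]_(z in unit_square R) ramp N k z.2 = ramp_moment nu k).
Proof.
move=> pi1.
have mS := @measurable_unit_square R.
have mI := @measurable_unit_itv R.
have I01 (x : R) : unit_itv R x -> 0 <= x <= 1 by rewrite /unit_itv/= in_itv.
have P1 := @psi_momentsP R _ _ _ _ pi mu (unit_square R) (unit_itv R) fst id N N0
  mS mI pi1 mu01.
have P2 := @psi_momentsP R _ _ _ _ pi nu (unit_square R) (unit_itv R) snd id N N0
  mS mI pi1 nu01.
have {}P1 := P1 (@measurable_fst _ _ _ _) (@measurable_id _ _ _)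
  (fun z h => I01 _ (proj1 h)) I01.
have {}P2 := P2 (@measurable_snd _ _ _ _) (@measurable_id _ _ _)
  (fun z h => I01 _ (proj2 h)) I01.
split=> [[_ /P1 H1 /P2 H2] k kN|H]; first by split; [exact: H1|exact: H2].
split=> //; first by apply/P1 => k /H[].
by apply/P2 => k /H[].
Qed.

Lemma measurable_ramp_fst k :
  measurable_fun (unit_square R) (fun z : RR => ramp N k z.1).
Proof. by apply/measurable_funTS/measurableT_comp => //; exact: measurable_ramp. Qed.

Lemma measurable_ramp_snd k :
  measurable_fun (unit_square R) (fun z : RR => ramp N k z.2).
Proof. by apply/measurable_funTS/measurableT_comp => //; exact: measurable_ramp. Qed.

(** Cell by cell, the integral of an absolute value dominates the absolute value of the integral,
    which the constraints fix. *)
Lemma moment_value_le pi : moment_problem mu nu N pi ->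
  (moment_value%:E <= transport_cost pi)%E.
Proof.
move=> mp; have pi1 : pi (unit_square R) = 1%E by case: mp.
move/(moment_problemP pi1) : mp => mp.
rewrite (transport_cost_ramp pi N0) lee_fin ler_pM2l ?invr_gt0 ?ltr0n//.
apply: ler_sum => k _; have [<- <-] := mp k (ltn_ord k).
apply: Rintegral_normB.
- exact: measurable_unit_square.
- exact: measurable_ramp_fst.
- exact: measurable_ramp_snd.
- by move=> z _; exact: ramp_itv.
- by move=> z _; exact: ramp_itv.
Qed.

End moment_value.

(** * A minimizer carried by the grid of mesh 1/N *)

Section minimizer.
Context {R : realType}.
Let RR := (measurableTypeR R * measurableTypeR R)%type.

(* For [p] nonincreasing and u uniform on [0,1], the law of [steps N p u] is the
   one on the grid {0, 1/N, ..., 1} for which r_k has mean [p k]. *)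
Definition steps (N : nat) (p : nat -> R) (u : R) : R :=
  N%:R^-1 * \sum_(k < N) (u < p k)%R%:R.

Lemma sum_ltn_ord (N n : nat) : (n <= N)%N -> \sum_(i < N) (i < n)%N%:R = n%:R :> R.
Proof.
move=> nN; have -> : n%:R = \sum_(i < n) 1 :> R by rewrite sumr_const card_ord.
rewrite (big_ord_widen N (fun=> 1) nN) [RHS]big_mkcond/=.
by apply: eq_bigr => i _; case: ltnP.
Qed.

(** As [p] is nonincreasing, the indices [i] with [u < p i] form an initial segment. If it contains
    [k], then [N%:R * steps N p u] is at least [k + 1] and the ramp saturates at 1; otherwise it is
    at most [k] and the ramp vanishes. *)
Lemma ramp_steps N p k u : (k < N)%N -> (forall i j, (i <= j)%N -> p j <= p i) ->
  ramp N k (steps N p u) = (u < p k)%R%:R.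
Proof.
move=> kN pP; have N0 : N%:R != 0 :> R by rewrite pnatr_eq0 -lt0n (leq_ltn_trans _ kN).
have E : N%:R * steps N p u = \sum_(i < N) (u < p i)%R%:R by rewrite mulVKf.
have [upk|pku] := ltP u (p k).
  have : k.+1%:R <= N%:R * steps N p u.
    rewrite E -(sum_ltn_ord kN); apply: ler_sum => i _; rewrite ler_nat ltnS.
    by case: (leqP i k) => [/pP pki|//]; rewrite (lt_le_trans upk pki).
  by rewrite /= mulr1n; case: (rampP N k (steps N p u)); rewrite -?natr1 => -[h ->]; lra.
have : N%:R * steps N p u <= k%:R.
  rewrite E -(sum_ltn_ord (ltnW kN)); apply: ler_sum => i _; rewrite ler_nat.
  by case: (ltnP i k) => [_|/pP ki]; [case: (_ < _)|rewrite ltNge (le_trans ki pku)].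
by rewrite /= mulr0n; case: (rampP N k (steps N p u)); rewrite -?natr1 => -[h ->]; lra.
Qed.

Lemma steps_itv N p u : 0 <= steps N p u <= 1.
Proof.
rewrite mulr_ge0 ?invr_ge0 ?sumr_ge0//=.
case: N => [|N]; first by rewrite /steps big_ord0 mulr0.
rewrite /steps ler_pdivrMl ?ltr0n// mulr1.
have -> : N.+1%:R = \sum_(i < N.+1) 1 :> R by rewrite sumr_const card_ord.
by apply: ler_sum => i _; case: (_ < _).
Qed.

Lemma measurable_steps N p :
  measurable_fun setT (steps N p : measurableTypeR R -> measurableTypeR R).
Proof.
apply: measurable_funM => //; apply: measurable_sum => k.
have -> : (fun u : measurableTypeR R => (u < p k)%R%:R) =
    \1_(`]-oo, p k[%classic) :> (_ -> R).
  by apply/funext => u; rewrite indicE mem_setE /= in_itv.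
exact: measurable_indic.
Qed.

Lemma Rintegral_unif01_lt (p : R) : 0 <= p <= 1 ->
  \int[unif01]_u (u < p)%R%:R = p.
Proof.
move=> p01; rewrite /Rintegral.
have -> : (fun u : measurableTypeR R => (u < p)%R%:R%:E : \bar R) =
    (fun u => (\1_(`]-oo, p[%classic) u)%:E).
  by apply/funext => u; rewrite indicE mem_setE /= in_itv.
by rewrite integral_indic// setIT; exact: (congr1 fine (unif01_lt p01)).
Qed.

Variables mu nu : probability (measurableTypeR R) R.
Hypotheses (mu01 : mu (unit_itv R) = 1%E) (nu01 : nu (unit_itv R) = 1%E).

Lemma moment_problem_minimizer N : (0 < N)%N -> exists2 pi : probability RR R,
  moment_problem mu nu N pi & transport_cost pi = (moment_value mu nu N)%:E.
Proof.
move=> N0; pose p := ramp_moment N mu; pose q := ramp_moment N nu.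
have mX := measurable_steps N p; have mY := measurable_steps N q.
have X01 := steps_itv N p; have Y01 := steps_itv N q.
have p01 : forall k, 0 <= p k <= 1 := ramp_moment_itv N mu.
have q01 : forall k, 0 <= q k <= 1 := ramp_moment_itv N nu.
have pP := ramp_moment_anti N mu : forall i j, (i <= j)%N -> p j <= p i.
have qP := ramp_moment_anti N nu : forall i j, (i <= j)%N -> q j <= q i.
pose pi := unif01_image mX mY.
have pi1 : pi (unit_square R) = 1%E := unif01_image_unit_square mX mY X01 Y01.
have mr (r : R) : measurable_fun setT (fun u : measurableTypeR R => (u < r)%R%:R : R).
  have -> : (fun u : measurableTypeR R => (u < r)%R%:R) =
      \1_(`]-oo, r[%classic) :> (_ -> R).
    by apply/funext => u; rewrite indicE mem_setE /= in_itv.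
  exact: measurable_indic.
exists pi.
  apply/(moment_problemP mu01 nu01 N0 pi1) => k kN; split.
    rewrite (Rintegral_unif01_image mX mY X01 Y01)/=.
    - by under eq_Rintegral do rewrite ramp_steps//; exact: Rintegral_unif01_lt.
    - exact: measurable_ramp_fst.
    - by move=> z _; exact: ramp_ge0.
  rewrite (Rintegral_unif01_image mX mY X01 Y01)/=.
  - by under eq_Rintegral do rewrite ramp_steps//; exact: Rintegral_unif01_lt.
  - exact: measurable_ramp_snd.
  - by move=> z _; exact: ramp_ge0.
rewrite (transport_cost_ramp pi N0); congr (_ * _)%:E; apply: eq_bigr => k _.
rewrite (Rintegral_unif01_image mX mY X01 Y01)//=; last first.
  apply: measurableT_comp => //; apply: measurable_funB.
    exact: measurable_ramp_fst.
  exact: measurable_ramp_snd.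
under eq_Rintegral do rewrite !ramp_steps//.
have b01 (b : bool) : (0 : R) <= b%:R <= 1 by case: b; rewrite ?ler01 ?lexx.
(* For a fixed [k] the indicators of [u < p k] and [u < q k] are ordered the same way at every [u],
   so the triangle inequality is an equality. *)
have [pq|/ltW qp] := leP (p k) (q k).
  rewrite Rintegral_normB_le//; first by rewrite !Rintegral_unif01_lt.
  - by move=> u _; exact: b01.
  - by move=> u _; exact: b01.
  - by move=> u _; rewrite ler_nat; case: ltP => // up; rewrite (lt_le_trans up).
under eq_Rintegral do rewrite distrC.
rewrite Rintegral_normB_le//; first by rewrite !Rintegral_unif01_lt// distrC.
- by move=> u _; exact: b01.
- by move=> u _; exact: b01.
- by move=> u _; rewrite ler_nat; case: ltP => // up; rewrite (lt_le_trans up).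
Qed.

Lemma I_moment_value N : (0 < N)%N -> I_ mu nu N = (moment_value mu nu N)%:E.
Proof.
move=> N0; apply/eqP; rewrite eq_le; apply/andP; split.
  have [pi mpi <-] := moment_problem_minimizer N0.
  by apply: ereal_inf_lbound; exists pi.
by apply: le_ereal_inf_tmp => _ [pi mpi <-]; exact: moment_value_le.
Qed.

End minimizer.

(** * Quantile coupling *)

Section cdf_of_theory.
Context {R : realType}.
Variable m : probability (measurableTypeR R) R.

Lemma cdf_ofE x : (cdf_of m x)%:E = m `]-oo, x]%classic.
Proof. by rewrite fineK// fin_num_measure. Qed.

Lemma cdf_of_nd : {homo cdf_of m : x y / x <= y}.
Proof.
move=> x y xy; rewrite -lee_fin !cdf_ofE le_measure ?inE//.
exact: subset_itvl.
Qed.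

Lemma cdf_of_itv x : 0 <= cdf_of m x <= 1.
Proof. by rewrite -!lee_fin cdf_ofE measure_ge0/= probability_le1. Qed.

Lemma cdf_of_oc a b : a <= b ->
  m `]a, b]%classic = (cdf_of m b - cdf_of m a)%:E.
Proof.
move=> ab; rewrite EFinB !cdf_ofE.
have -> : `]a, b]%classic = `]-oo, b] `\` `]-oo, a] :> set R.
  by rewrite -[RHS]setCK setCD setCitvl setUC -[LHS]setCK setCitv.
rewrite measureD ?setIidr//; first exact: subset_itvl.
by rewrite -ge0_fin_numE// fin_num_measure.
Qed.

(** The identity is a random variable with law [m]; through it, right-continuity of the distribution
    function of a random variable applies to [cdf_of m]. *)
Let idTR : measurableTypeR R -> R := idfun.

#[local] HB.instance Definition _ :=
  @isMeasurableFun.Build _ _ _ _ idTR (@measurable_id _ _ setT).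

Lemma cdf_of_right_continuous : right_continuous (cdf_of m).
Proof.
move=> a; apply: fine_cvg.
rewrite fineK ?fin_num_measure//.
exact: (@cdf_right_continuous _ _ _ m (idTR : {RV m >-> R})).
Qed.

Hypothesis m01 : m (unit_itv R) = 1%E.

Lemma cdf_of1 : cdf_of m 1 = 1.
Proof.
apply/eqP; rewrite eq_le; have /andP[_ ->/=] := cdf_of_itv 1.
rewrite -lee_fin cdf_ofE -m01 le_measure ?inE//; first exact: measurable_unit_itv.
by move=> x; rewrite /unit_itv /= !in_itv/= => /andP[].
Qed.

Lemma cdf_of_lt0 x : x < 0 -> cdf_of m x = 0.
Proof.
move=> x0; apply/eqP; rewrite eq_le; have /andP[->/= _] := cdf_of_itv x.
rewrite andbT -lee_fin cdf_ofE.
apply: (@le_trans _ _ (m (~` unit_itv R))); last first.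
  rewrite probability_setC; last exact: measurable_unit_itv.
  by rewrite [X in (_ - X)%E]m01 subee.
rewrite le_measure ?inE//; first by apply: measurableC; exact: measurable_unit_itv.
by move=> y; rewrite /unit_itv /= !in_itv/= => yx /andP[]; lra.
Qed.

(* The alternative [x = 1] makes the set nonempty for u > 1. *)
Definition quantile (u : measurableTypeR R) : measurableTypeR R :=
  inf [set x | 0 <= x <= 1 /\ (u <= cdf_of m x \/ x = 1)].

Let lb_quantile u : has_inf [set x | 0 <= x <= 1 /\ (u <= cdf_of m x \/ x = 1)].
Proof.
split; first by exists 1; split; [rewrite lexx ler01|right].
by exists 0 => x [/andP[]].
Qed.

Lemma quantile_itv u : 0 <= quantile u <= 1.
Proof.
apply/andP; split; first by apply: lb_le_inf; [case: (lb_quantile u)|move=> x [/andP[]]].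
by apply: ge_inf; [case: (lb_quantile u)|split; [rewrite lexx ler01|right]].
Qed.

(** The Galois connection between quantile and distribution function; the direction from left to
    right rests on right-continuity. The bound [x < 1] excludes the alternative [x = 1] of the
    defining set, which would break the equivalence for [u > 1]. *)
Lemma quantile_le u x : 0 <= x < 1 -> (quantile u <= x) = (u <= cdf_of m x).
Proof.
move=> /andP[x0 x1]; apply/idP/idP => [Xx|ux]; last first.
  by apply: ge_inf; [case: (lb_quantile u)|split; [rewrite x0 ltW|left]].
rewrite leNgt; apply/negP => Fu.
have : \forall y \near x^'+, cdf_of m y < u.
  exact: (cvgr_lt _ (@cdf_of_right_continuous x) _ Fu).
move=> H; near x^'+ => y.
have xy : x < y by near: y; exact: nbhs_right_gt.
have y1 : y < 1 by near: y; exact: nbhs_right_lt.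
have yu : cdf_of m y < u by near: y.
(* As [quantile u <= x < y], some [z] of the defining set lies below [y]. Either
   [u <= cdf_of m z <= cdf_of m y < u], or [z = 1] although [y < 1]. *)
have [z [/andP[z0 z1] [uz|z1']]] := @inf_adherent _ _ (y - quantile u)
  (ltac:(rewrite subr_gt0; exact: le_lt_trans xy)) (lb_quantile u); rewrite addrC subrK => zy.
  by have := cdf_of_nd (ltW zy); lra.
lra.
Unshelve. all: by end_near. Qed.

Lemma quantile_nd : {homo quantile : u v / u <= v}.
Proof.
move=> u v uv; apply: lb_le_inf; first by case: (lb_quantile v).
move=> x [x01 ux]; apply: ge_inf; first by case: (lb_quantile u).
split=> //; case: ux => [vx|->]; by [left; exact: le_trans vx|right].
Qed.

Lemma measurable_quantile :
  measurable_fun setT quantile.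
Proof. by apply: nondecreasing_measurable => //; exact: quantile_nd. Qed.

(** On [0,1[ the preimage is the half-line up to [cdf_of m x], by [quantile_le]; outside that range
    both sides are 0 or 1. *)
Lemma unif01_quantile_le x : 
  unif01 (quantile @^-1` `]-oo, x]%classic) = m `]-oo, x]%classic.
Proof.
rewrite -cdf_ofE.
have [x0|x0] := ltP x 0.
  rewrite cdf_of_lt0// [X in unif01 X](_ : _ = set0) ?measure0//.
  rewrite -subset0 => u /=; rewrite in_itv/=.
  by case/andP: (quantile_itv u) => h _ /(le_trans h); rewrite leNgt x0.
have [x1|x1] := ltP x 1.
  rewrite -unif01_le ?cdf_of_itv//; congr (unif01 _).
  apply/seteqP; split=> u; rewrite /= !in_itv/= quantile_le ?x0//.
have -> : cdf_of m x = 1.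
  by apply/eqP; rewrite eq_le -{2}cdf_of1 cdf_of_nd//; case/andP: (cdf_of_itv x) => _ ->.
rewrite [X in unif01 X](_ : _ = setT); first exact: probability_setT.
by apply/seteqP; split=> // u _ /=; rewrite in_itv/= (le_trans _ x1)//; case/andP: (quantile_itv u).
Qed.

(** Two probabilities agreeing on a generating family stable under intersection coincide. The
    generator consists of open upper half-lines, the complements of those in
    [unif01_quantile_le]. *)
Lemma unif01_quantile (A : set (measurableTypeR R)) : measurable A -> unif01 (quantile @^-1` A) = m A.
Proof.
pose Q : {mfun measurableTypeR R >-> measurableTypeR R} :=
  mfun_Sub (mem_set measurable_quantile).
move=> mA; suff: distribution unif01 Q A = m A by [].
apply: (@measure_unique _ R (measurableTypeR R) (@RGenOInfty.G R)
  (fun k => `](- k%:R), +oo[%classic) _ _ _ _ (distribution unif01 Q) m) => //.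
- exact: RGenOInfty.measurableE.
- move=> _ _ [x ->] [y ->]; exists (Num.max x y).
  by apply/seteqP; split=> z /=; rewrite !in_itv/= !andbT gt_max; [move=> [-> ->]|move=> /andP].
- by move=> k; exists (- k%:R).
- rewrite -subTset => x _; exists (Num.truncn `|x|).+1 => //=.
  rewrite in_itv/= andbT ltrNl (le_lt_trans _ (truncnS_gt _))// ler_normr lexx orbT//.
- move=> _ [x ->]; rewrite -setCitvl.
  have mx : measurable (`]-oo, x]%classic : set (measurableTypeR R)) by [].
  apply: (etrans (probability_setC (distribution unif01 Q) mx)).
  apply: (etrans _ (esym (probability_setC m mx))).
  by congr (_ - _)%E; exact: unif01_quantile_le.
- move=> k; rewrite (le_lt_trans (probability_le1 _ _)) ?ltry//.
Qed.

End cdf_of_theory.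

Section quantile_coupling.
Context {R : realType}.
Let RR := (measurableTypeR R * measurableTypeR R)%type.

(** One change of variables for two uses: the projections of a coupling and the quantile
    functions. *)
Lemma ramp_moment_pushforward d (T : measurableType d) (P : probability T R)
    (f : T -> measurableTypeR R) (D : set T)
    (m : probability (measurableTypeR R) R) (N k : nat) :
  measurable_fun setT f -> measurable D -> P D = 1%E ->
  (forall x, D x -> unit_itv R (f x)) ->
  (forall A, measurable A -> pushforward P f A = m A) ->
  \int[P]_(x in D) ramp N k (f x) = ramp_moment N m k.
Proof.
move=> mf mD PD fD Pf; congr fine.
pose F : {mfun T >-> measurableTypeR R} := mfun_Sub (mem_set mf).
rewrite [RHS](eq_measure_integral (distribution P F)); last first.
  by move=> A mA _; exact: (esym (Pf A mA)).
have mr : measurable_fun setT (fun y : measurableTypeR R => (ramp N k y)%:E).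
  by apply/measurable_EFinP; exact: measurable_ramp.
rewrite ge0_integral_pushforward//; last 3 first.
- exact: measurable_unit_itv.
- exact: measurable_funTS.
- by move=> y _; rewrite lee_fin ramp_ge0.
(* The preimage of [unit_itv R] contains [D] and may be larger, but the excess is negligible. *)
have PDc : P (~` D) = 0%E by rewrite probability_setC// [X in (_ - X)%E]PD subee.
rewrite (@ge0_negligible_integral _ _ _ P (F @^-1` unit_itv R) (~` D)); first last.
- exact: PDc.
- by move=> t _; rewrite lee_fin ramp_ge0.
- by apply: measurable_funTS; exact: measurableT_comp.
- by rewrite -[X in measurable X]setTI; exact: (mf measurableT _ (@measurable_unit_itv R)).
- exact: measurableC.
congr (integral _ _ _); rewrite setDE setCK; apply/esym/setIidr => t Dt.
exact: fD.
Qed.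

Variables mu nu : probability (measurableTypeR R) R.
Hypotheses (mu01 : mu (unit_itv R) = 1%E) (nu01 : nu (unit_itv R) = 1%E).

Definition quantile_coupling : probability RR R :=
  unif01_image (measurable_quantile mu) (measurable_quantile nu).

Lemma quantile_coupling_couplings : couplings mu nu quantile_coupling.
Proof.
split.
- exact: (unif01_image_unit_square _ _ (quantile_itv mu) (quantile_itv nu)).
- by move=> A mA; exact: unif01_quantile.
- by move=> B mB; exact: unif01_quantile.
Qed.

(** A coupling has the full marginals, hence the prescribed moments, so [I_] is an infimum over a
    larger set. *)
Lemma I_le_W1 N : (0 < N)%N -> (I_ mu nu N <= W1 mu nu)%E.
Proof.
move=> N0; apply: le_ereal_inf => _ [pi [pi1 pimu pinu] <-]; exists pi => //.
apply/(moment_problemP mu01 nu01 N0 pi1) => k kN; split.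
  apply: ramp_moment_pushforward => //; first exact: measurable_unit_square.
  by move=> z [].
apply: ramp_moment_pushforward => //; first exact: measurable_unit_square.
by move=> z [].
Qed.

Lemma ramp_moment_quantile (m : probability (measurableTypeR R) R) N k : m (unit_itv R) = 1%E ->
  \int[unif01]_u ramp N k (quantile m u) = ramp_moment N m k.
Proof.
move=> m01; apply: ramp_moment_pushforward => //.
- exact: measurable_quantile.
- exact: probability_setT.
- by move=> u _; rewrite /unit_itv/= in_itv/=; exact: quantile_itv.
- by move=> A mA; exact: unif01_quantile.
Qed.

Lemma W1_le N : (0 < N)%N ->
  (W1 mu nu <= (N%:R^-1 * \sum_(k < N)
    \int[unif01]_u `|ramp N k (quantile mu u) - ramp N k (quantile nu u)|)%:E)%E.
Proof.
move=> N0; apply: ereal_inf_le.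
exists (transport_cost quantile_coupling).
  by exists quantile_coupling => //; exact: quantile_coupling_couplings.
rewrite (transport_cost_ramp _ N0) lee_fin le_eqVlt; apply/orP; left; apply/eqP.
congr (_ * _); apply: eq_bigr => k _.
apply: (Rintegral_unif01_image _ _ (quantile_itv mu) (quantile_itv nu)) => //.
apply: measurableT_comp => //; apply: measurable_funB.
  exact: measurable_ramp_fst.
exact: measurable_ramp_snd.
Qed.

End quantile_coupling.

(** * Ramps of quantiles on a single cell *)

Section cell_bounds.
Context {R : realType}.
Implicit Types m : probability (measurableTypeR R) R.

Lemma measurable_ramp_quantile m N k :
  measurable_fun setT (fun u => ramp N k (quantile m u)).
Proof.
apply: measurableT_comp; first exact: measurable_ramp.
exact: measurable_quantile.
Qed.

(** A larger distribution function means a smaller quantile. A comparison on one cell suffices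
    because the ramp is constant on either side of it. *)
Lemma le_ramp_quantile m1 m2 N k u : (k < N)%N ->
  (forall x, k%:R / N%:R <= x < k.+1%:R / N%:R -> cdf_of m1 x <= cdf_of m2 x) ->
  ramp N k (quantile m2 u) <= ramp N k (quantile m1 u).
Proof.
move=> kN F12; rewrite leNgt; apply/negP => ramp12.
have N0 : 0 < N%:R :> R by rewrite ltr0n (leq_ltn_trans _ kN).
set X := quantile m1 u in ramp12; set Y := quantile m2 u in ramp12.
have Xk : X < k.+1%:R / N%:R.
  rewrite ltr_pdivlMr// mulrC.
  have := ramp_itv N k Y.
  by case: (rampP N k X) ramp12; rewrite -?natr1 => -[h ->]; lra.
(* This moves [X] up to the left end of the cell if it lies before it. The ramp does not change, and
   at the new point the hypothesis on the cell gives [Y <= x]. *)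
pose x := Num.max X (k%:R / N%:R).
have xk : k%:R / N%:R <= x < k.+1%:R / N%:R.
  by rewrite le_max lexx orbT/= gt_max Xk/= ltr_pM2r ?invr_gt0// ltr_nat.
have k1 : k.+1%:R / N%:R <= 1 :> R by rewrite ler_pdivrMr// mul1r ler_nat.
have k0 : 0 <= k%:R / N%:R :> R by rewrite divr_ge0.
have x01 : 0 <= x < 1.
  by case/andP: xk => kx xk; rewrite (le_trans k0)// (lt_le_trans xk).
have Yx : Y <= x.
  by rewrite quantile_le// (le_trans _ (F12 _ xk))// -quantile_le// le_max lexx.
have : ramp N k x = ramp N k X.
  rewrite /x; have [//|kX] := leP (k%:R / N%:R) X.
  have : N%:R * X <= k%:R by rewrite mulrC -ler_pdivlMr// ltW.
  have : N%:R * (k%:R / N%:R) = k%:R :> R by field; rewrite gt_eqF.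
  by case: (rampP N k X) => -[h ->]; case: (rampP N k (k%:R / N%:R : R)) => -[h' ->];
    move: h h'; rewrite -?natr1; lra.
by have := le_ramp N k Yx; lra.
Qed.

End cell_bounds.

Section cell_fubini.
Context {R : realType}.
Variables mu nu : probability (measurableTypeR R) R.
Hypotheses (mu01 : mu (unit_itv R) = 1%E) (nu01 : nu (unit_itv R) = 1%E).
Variables (N k : nat).
Hypothesis kN : (k < N)%N.
Let RR := (measurableTypeR R * measurableTypeR R)%type.
Let X := quantile mu.
Let Y := quantile nu.
Let a : R := k%:R / N%:R.
Let b : R := k.+1%:R / N%:R.

Let N0 : 0 < N%:R :> R. Proof. by rewrite ltr0n (leq_ltn_trans _ kN). Qed.

(* Tonelli is applied to this set: its section at u contains the part of the cell
   between the two quantiles, and its section at a point x of the cell is the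
   set of u between F_mu(x) and F_nu(x). *)
Definition gap_set : set RR := [set z | ((a <= z.2) && (z.2 < b)) &&
  (((X z.1 <= z.2) && (z.2 < Y z.1)) || ((Y z.1 <= z.2) && (z.2 < X z.1)))].

Lemma measurable_gap_set : measurable gap_set.
Proof.
have mX : measurable_fun setT (fun z : RR => X z.1).
  by apply: measurableT_comp => //; exact: measurable_quantile.
have mY : measurable_fun setT (fun z : RR => Y z.1).
  by apply: measurableT_comp => //; exact: measurable_quantile.
have m2 : measurable_fun setT (fun z : RR => z.2) by exact: measurable_snd.
have : measurable_fun setT (fun z : RR => ((a <= z.2) && (z.2 < b)) &&
  (((X z.1 <= z.2) && (z.2 < Y z.1)) || ((Y z.1 <= z.2) && (z.2 < X z.1)))).
  apply: measurable_and.
    by apply: measurable_and; [exact: measurable_fun_ler|exact: measurable_fun_ltr].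
  by apply: measurable_or; apply: measurable_and;
    by [exact: measurable_fun_ler|exact: measurable_fun_ltr].
move=> /(_ measurableT [set true]); rewrite setTI; exact.
Qed.

(** The ramp has slope [N] on the cell and is constant elsewhere, so its increment is [N] times the
    length of the part of the cell between the two quantiles. *)
Lemma ramp_gap_le u : (`|ramp N k (X u) - ramp N k (Y u)|%:E <=
  N%:R%:E * lebesgue_measure (xsection gap_set u))%E.
Proof.
have mS := measurable_gap_set.
have H x y (A : set (measurableTypeR R)) : measurable A -> x <= y ->
    `[Num.max a x, Num.min b y[%classic `<=` A ->
    ((ramp N k y - ramp N k x)%:E <= N%:R%:E * lebesgue_measure A)%E.
  move=> mA xy sA.
  apply: (@le_trans _ _ (N%:R%:E * lebesgue_measure `[Num.max a x, Num.min b y[%classic)%E);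
    last by rewrite lee_pmul2l//= ?lte_fin// le_measure// inE.
  rewrite lebesgue_measure_itv/= lte_fin.
  have aN : N%:R * a = k%:R by rewrite /a mulrC divfK// gt_eqF.
  have bN : N%:R * b = k.+1%:R by rewrite /b mulrC divfK// gt_eqF.
  have xyN : N%:R * x <= N%:R * y by rewrite ler_pM2l.
  case: ifPn => [|].
    rewrite -EFinD -EFinM lee_fin mulrBr -(ltr_pM2l N0).
    rewrite minr_pMr ?maxr_pMr ?(ltW N0)// aN bN lt_min !gt_max.
    move=> /andP[/andP[_ xk] /andP[ky _]].
    have -> : ramp N k y = Num.min k.+1%:R (N%:R * y) - k%:R.
      by move: ky xk; rewrite -natr1; case: (rampP N k y) => -[h ->];
        move: h; rewrite -?natr1; case: (leP (k%:R + 1) (N%:R * y)); lra.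
    have -> : ramp N k x = Num.max k%:R (N%:R * x) - k%:R.
      by move: xk; rewrite -natr1; case: (rampP N k x) => -[h ->];
        move: h; rewrite -?natr1; case: (leP k%:R (N%:R * x)); lra.
    by rewrite opprB addrA subrK.
  (* The interval is empty: [x] is at or beyond the right end of the cell, or [y] at or before the
     left end, or [y <= x]. In each case the increment is at most 0. *)
  rewrite -leNgt -(ler_pM2l N0) minr_pMr ?maxr_pMr ?(ltW N0)// aN bN mule0 lee_fin.
  rewrite subr_le0 ge_min !le_max ler_nat ltnn/= => /orP[kx|/orP[yk|yx]].
  - have -> : ramp N k x = 1.
      by case: (rampP N k x) => -[h ->//]; move: h kx; rewrite -natr1; lra.
    by case/andP: (ramp_itv N k y).
  - have -> : ramp N k y = 0.
      by case: (rampP N k y) => -[h ->//]; move: h yk; rewrite -?natr1; lra.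
    exact: ramp_ge0.
  - by apply: le_ramp; rewrite -(ler_pM2l N0).
have mA : measurable (xsection gap_set u) by exact: measurable_xsection.
have [YX|/ltW XY] := leP (Y u) (X u).
  rewrite ger0_norm ?subr_ge0 ?le_ramp//; apply: H => // x /=.
  rewrite in_itv/= ge_max lt_min => /andP[/andP[ax Yx] /andP[xb xX]].
  by apply/xsectionP; rewrite /gap_set/= ax xb Yx xX orbT.
rewrite distrC ger0_norm ?subr_ge0 ?le_ramp//; apply: H => // x /=.
rewrite in_itv/= ge_max lt_min => /andP[/andP[ax Yx] /andP[xb xX]].
by apply/xsectionP; rewrite /gap_set/= ax xb Yx xX.
Qed.

Lemma unif01_oc (p q : R) : 0 <= p -> p <= q -> q <= 1 ->
  unif01 `]p, q]%classic = (q - p)%:E.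
Proof.
move=> p0 pq q1; have cdfE r : 0 <= r <= 1 -> cdf_of unif01 r = r.
  by move=> r01; exact: (congr1 fine (unif01_le r01)).
by rewrite (cdf_of_oc unif01 pq) !cdfE// ?p0 ?(le_trans pq) ?(le_trans p0).
Qed.

Variable delta : R.
Hypothesis deltaP : forall x, a <= x < b -> `|cdf_of mu x - cdf_of nu x| <= delta.

Lemma unif01_gap_le x :
  (unif01 (ysection gap_set x) <= delta%:E * (\1_(`[a, b[%classic) x)%:E)%E.
Proof.
have mA : measurable (ysection gap_set x) by apply: measurable_ysection; exact: measurable_gap_set.
rewrite indicE mem_setE /= in_itv/=; have [axb|naxb] := boolP (a <= x < b); last first.
  rewrite mule0 [X in unif01 X](_ : _ = set0) ?measure0//.
  by rewrite -subset0 => u /ysectionP; rewrite /gap_set/= (negbTE naxb).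
rewrite mule1.
have x01 : 0 <= x < 1.
  have /andP[ax xb] := axb; rewrite (le_trans _ ax) ?divr_ge0//=.
  by rewrite (lt_le_trans xb)// ler_pdivrMr// mul1r ler_nat.
set p := cdf_of mu x; set q := cdf_of nu x.
have /andP[p0 p1] := cdf_of_itv mu x; have /andP[q0 q1] := cdf_of_itv nu x.
(* By [quantile_le], [X u <= x] reads [u <= p] and [x < Y u] reads [q < u], and symmetrically, so
   the section lies in a half-open interval with ends [p] and [q]. *)
have E u : ysection gap_set x u -> (p < u <= q) || (q < u <= p).
  move=> /ysectionP; rewrite /gap_set/= axb/=.
  rewrite /X /Y !ltNge !quantile_le// -!ltNge => /orP[]/andP[-> ->];
    by rewrite ?orbT.
apply: (@le_trans _ _ `|p - q|%:E); last by rewrite lee_fin deltaP.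
have [pq|/ltW qp] := leP p q.
  rewrite distrC ger0_norm ?subr_ge0// -unif01_oc// le_measure ?inE//.
  move=> u /E /orP[|]; rewrite /= in_itv/=; lra.
rewrite ger0_norm ?subr_ge0// -unif01_oc// le_measure ?inE//.
move=> u /E /orP[|]; rewrite /= in_itv/=; lra.
Qed.

(** After Tonelli on [gap_set], the integral over the cell is at most [delta] times its length 1/N,
    which cancels the slope [N]. *)
Lemma Rintegral_ramp_gap_le :
  \int[unif01]_u `|ramp N k (X u) - ramp N k (Y u)| <= delta.
Proof.
have mS := measurable_gap_set.
have mr : measurable_fun setT (fun u => `|ramp N k (X u) - ramp N k (Y u)|).
  by apply: measurableT_comp => //; apply: measurable_funB; exact: measurable_ramp_quantile.
have mP := measurable_fun_xsection lebesgue_measure mS.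
have mQ := measurable_fun_ysection unif01 mS.
rewrite -lee_fin EFin_Rintegral//; last first.
  move=> u _; rewrite normr_id ler_norml.
  by move: (ramp_itv N k (X u)) (ramp_itv N k (Y u)); lra.
apply: (@le_trans _ _ (\int[unif01]_u (N%:R%:E * lebesgue_measure (xsection gap_set u)))%E).
  apply: ge0_le_integral => //.
  - exact/measurable_EFinP.
  - by apply: measurable_funeM.
  - by move=> u _; exact: ramp_gap_le.
rewrite ge0_integralZl//.
have -> : (\int[unif01]_u lebesgue_measure (xsection gap_set u))%E =
   (\int[lebesgue_measure]_x unif01 (ysection gap_set x))%E.
  have := @indic_fubini_tonelli _ _ _ _ R unif01 lebesgue_measure _ mS.
  by rewrite indic_fubini_tonelli_FE// indic_fubini_tonelli_GE.
apply: (@le_trans _ _ (N%:R%:E * \int[lebesgue_measure]_x (delta%:E * (\1_(`[a, b[%classic) x)%:E))%E).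
  rewrite lee_pmul2l//= ?lte_fin//; apply: ge0_le_integral => //.
  - by apply: measurable_funeM; apply/measurable_EFinP; exact: measurable_indic.
  - by move=> x _; exact: unif01_gap_le.
have delta0 : 0 <= delta.
  apply: (le_trans (normr_ge0 _)); apply: (deltaP (x := a)).
  by rewrite lexx/= ltr_pM2r ?invr_gt0// ltr_nat.
rewrite ge0_integralZl//; last first.
  by apply/measurable_EFinP; exact: measurable_indic.
have ab : a < b by rewrite ltr_pM2r ?invr_gt0// ltr_nat.
have lab : lebesgue_measure (`[a, b[%classic : set (measurableTypeR R)) = (b - a)%:E.
  by rewrite lebesgue_measure_itv/= lte_fin ab.
rewrite integral_indic// setIT [X in (_ * (_ * X))%E]lab -!EFinM lee_fin.
by rewrite /a /b -mulrBl -natr1 [k%:R + 1]addrC addrK mul1r mulrCA mulfV ?mulr1// gt_eqF.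
Qed.

End cell_fubini.

(** * Lipschitz bound on the difference of the distribution functions *)

Section cdf_lipschitz.
Context {R : realType}.
Variables mu nu : probability (measurableTypeR R) R.
Variables rho_mu rho_nu : measurableTypeR R -> R.
Hypotheses (rho_muP : is_density mu rho_mu) (rho_nuP : is_density nu rho_nu).
Hypothesis fin_rho : finite_norm (lebesgue01 R) +oo%E (rho_mu \- rho_nu).

Definition density_gap : R := fine ('N[lebesgue01 R]_+oo[EFin \o (rho_mu \- rho_nu)%R]%E).

Lemma density_gapE :
  density_gap%:E = 'N[lebesgue01 R]_+oo[EFin \o (rho_mu \- rho_nu)%R]%E.
Proof. by rewrite fineK// ge0_fin_numE// Lnorm_ge0. Qed.

Lemma density_gap_ge0 : 0 <= density_gap.
Proof. by rewrite fine_ge0// Lnorm_ge0. Qed.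

(** The exceptional set of the norm is null for [lebesgue01 R] only; its intersection with
    [unit_itv R] is Lebesgue-null and still covers the bad points of [D]. *)
Lemma ae_density_gap (D : set (measurableTypeR R)) : D `<=` unit_itv R ->
  {ae (@lebesgue_measure R), forall x, D x -> `|rho_mu x - rho_nu x| <= density_gap}.
Proof.
move=> D01.
have : \forall x \ae lebesgue01 R, (`|(rho_mu x - rho_nu x)%:E| <= density_gap%:E)%E.
  (* At exponent [+oo] the norm is the essential supremum only when the total mass is positive; here
     the mass is 1. *)
  rewrite density_gapE unlock ifT; first exact: ess_sup_ge.
  rewrite /lebesgue01 /= /mrestr setTI /unit_itv lebesgue_measure_itv/= lte_fin ltr01.
  by rewrite sube0 lte_fin ltr01.
move=> [A [mA A0 sA]]; exists (A `&` unit_itv R); split => //.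
  by apply: measurableI => //; exact: measurable_unit_itv.
move=> x /= /not_implyP[Dx Hx]; split; last exact: D01.
by apply: sA => /=; rewrite lee_fin.
Qed.

(** The increment of the difference is the integral of [rho_mu - rho_nu] over []x, y]], and the
    integrand is almost everywhere bounded by [density_gap]. *)
Lemma cdf_lipschitz x y : 0 <= x -> x <= y -> y <= 1 ->
  `|(cdf_of mu y - cdf_of nu y) - (cdf_of mu x - cdf_of nu x)| <= density_gap * (y - x).
Proof.
move=> x0 xy y1.
pose D : set (measurableTypeR R) := `]x, y]%classic.
have mD : measurable D by exact: measurable_itv.
have D01 : D `<=` unit_itv R.
  move=> z; rewrite /D /unit_itv /= !in_itv/= => /andP[xz zy].
  by rewrite (le_trans x0 (ltW xz)) (le_trans zy).
have [imu dmu] := rho_muP; have [inu dnu] := rho_nuP.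
have mI := @measurable_unit_itv R.
have imuD : lebesgue_measure.-integrable D (EFin \o rho_mu) by exact: (integrableS mI mD D01 imu).
have inuD : lebesgue_measure.-integrable D (EFin \o rho_nu) by exact: (integrableS mI mD D01 inu).
have -> : cdf_of mu y - cdf_of nu y - (cdf_of mu x - cdf_of nu x) =
    (cdf_of mu y - cdf_of mu x) - (cdf_of nu y - cdf_of nu x) by ring.
rewrite -lee_fin.
have -> : (`|(cdf_of mu y - cdf_of mu x) - (cdf_of nu y - cdf_of nu x)|%:E =
  `|\int[lebesgue_measure]_(z in D) (rho_mu z - rho_nu z)%:E|)%E.
  under eq_integral do rewrite EFinB.
  by rewrite integralB_EFin// -dmu// -dnu// !cdf_of_oc.
have mf : measurable_fun D (fun z => (rho_mu z - rho_nu z)%:E).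
  have := integrableB mD imuD inuD.
  by move=> /integrableP[].
apply: (le_trans (le_abse_integral _ mD mf)).
apply: (@le_trans _ _ (\int[lebesgue_measure]_(z in D) density_gap%:E)%E).
  apply: ae_ge0_le_integral => //.
  - exact: measurableT_comp.
  - by move=> z _; rewrite lee_fin density_gap_ge0.
  - by have := ae_density_gap D01; apply: filterS => z Hz Dz; rewrite lee_fin Hz.
have lD : lebesgue_measure D = (y - x)%:E.
  rewrite /D lebesgue_measure_itv/= lte_fin.
  by case: ltgtP xy => // -> _; rewrite subrr.
by rewrite integral_cst// [X in (_ * X)%E]lD -EFinM.
Qed.

End cdf_lipschitz.

(** * Counting sign changes *)

Section sign_changes.
Context {R : realType}.
Implicit Types (N k : nat).

(** Open cells are disjoint. In the rescaled variable [N x], this charges each point of sign change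
    to at most one cell. *)
Lemma sum_open_cells_le1 n (t : R) : \sum_(k < n) (k%:R < t < k.+1%:R)%R%:R <= 1 :> R.
Proof.
(* The bound is strengthened for the induction: nothing is counted while [n <= t]. *)
suff H : \sum_(k < n) (k%:R < t < k.+1%:R)%R%:R <= (t < n%:R)%R%:R :> R.
  by rewrite (le_trans H)// lern1; case: (_ < _).
elim: n => [|n IH]; first by rewrite big_ord0.
rewrite big_ord_recr/= (le_trans (lerD IH (lexx _)))// -natrD ler_nat -natr1.
by case: (ltP n%:R t); case: (ltP t n%:R); case: (ltP t (n%:R + 1)) => //=; lra.
Qed.

(** A cell with none of [x 1], ..., [x Q] in its interior fits between two consecutive points of the
    subdivision, where all products of values of [G] are nonnegative. *)
Lemma sign_on_cell Q (G : R -> R) (x : nat -> R) N k : (k < N)%N ->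
  x 0%N = 0 -> x Q.+1 = 1 ->
  (forall q, (1 <= q <= Q.+1)%N ->
    forall y z, x q.-1 <= y <= x q -> x q.-1 <= z <= x q -> 0 <= G y * G z) ->
  [\/ forall y, k%:R / N%:R <= y < k.+1%:R / N%:R -> G y <= 0,
      forall y, k%:R / N%:R <= y < k.+1%:R / N%:R -> 0 <= G y
    | exists q : 'I_Q, k%:R < N%:R * x q.+1 < k.+1%:R].
Proof.
move=> kN x0 xQ Gx.
have N0 : 0 < N%:R :> R by rewrite ltr0n (leq_ltn_trans _ kN).
have [?|noq] := pselect (exists q : 'I_Q, k%:R < N%:R * x q.+1 < k.+1%:R).
  exact: Or33.
have exq : exists q, k.+1%:R <= N%:R * x q.
  by exists Q.+1; rewrite xQ mulr1 ler_nat.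
(* The index [q.+1] is the first whose point is at or past the right end of the cell. Then [x q] is
   before that end and not interior, hence at or before the left end. *)
case: (ex_minnP exq) => -[|q]; first by rewrite x0 mulr0 lern0.
move=> bq qmin.
have qb : N%:R * x q < k.+1%:R by rewrite ltNge; apply/negP => /qmin; rewrite ltnn.
have qQ : (q <= Q)%N.
  by have := qmin Q.+1; rewrite xQ mulr1 ler_nat => /(_ kN).
have qa : N%:R * x q <= k%:R.
  case: q bq qmin qb qQ => [|q] bq qmin qb qQ; first by rewrite x0 mulr0.
  by rewrite leNgt; apply/negP => kq; apply: noq; exists (Ordinal qQ); rewrite kq.
have sub y : k%:R / N%:R <= y < k.+1%:R / N%:R -> x q <= y <= x q.+1.
  rewrite ler_pdivrMr// ltr_pdivlMr// mulrC => /andP[ky yk].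
  apply/andP; split; rewrite -(ler_pM2l N0); first exact: (le_trans qa).
  exact: (le_trans (ltW yk)).
have GG y z : k%:R / N%:R <= y < k.+1%:R / N%:R ->
    k%:R / N%:R <= z < k.+1%:R / N%:R -> 0 <= G y * G z.
  by move=> /sub ? /sub ?; apply: (Gx q.+1).
(* One point with [G y > 0] forces [G] to be nonnegative on the cell; without such a point [G] is
   nonpositive there. *)
have [[y yk Gy]|nG] := pselect (exists2 y, k%:R / N%:R <= y < k.+1%:R / N%:R & 0 < G y).
  by apply: Or32 => z zk; rewrite -(pmulr_rge0 _ Gy) GG.
apply: Or31 => y yk; rewrite leNgt; apply/negP => Gy; apply: nG.
by exists y.
Qed.

Variables mu nu : probability (measurableTypeR R) R.
Hypotheses (mu01 : mu (unit_itv R) = 1%E) (nu01 : nu (unit_itv R) = 1%E).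
Let X := quantile mu.
Let Y := quantile nu.
Let G (x : R) := cdf_of mu x - cdf_of nu x.

Lemma Rintegral_ramp_quantile_le N k : (k < N)%N ->
  (forall x, k%:R / N%:R <= x < k.+1%:R / N%:R -> cdf_of mu x <= cdf_of nu x) \/
  (forall x, k%:R / N%:R <= x < k.+1%:R / N%:R -> cdf_of nu x <= cdf_of mu x) ->
  \int[unif01]_u `|ramp N k (X u) - ramp N k (Y u)| =
  `|ramp_moment N mu k - ramp_moment N nu k|.
Proof.
move=> kN H; rewrite -!ramp_moment_quantile//.
case: H => [H|H]; last first.
  rewrite Rintegral_normB_le//; try exact: measurable_ramp_quantile.
  - by move=> u _; exact: ramp_itv.
  - by move=> u _; exact: ramp_itv.
  - by move=> u _; exact: le_ramp_quantile.
under eq_Rintegral do rewrite distrC.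
rewrite Rintegral_normB_le//; try exact: measurable_ramp_quantile.
- by rewrite distrC.
- by move=> u _; exact: ramp_itv.
- by move=> u _; exact: ramp_itv.
- by move=> u _; exact: le_ramp_quantile.
Qed.

Variables (Q : nat) (L : R).
Hypothesis L0 : 0 <= L.
Hypothesis GL : forall x y, 0 <= x -> x <= y -> y <= 1 -> `|G y - G x| <= L * (y - x).
Hypothesis signG : changes_sign_at_most Q G.

(** Cells of constant sign contribute exactly their moment gap. Any other cell contributes at most
    [L / N], charged to a point of sign change inside it; exchanging the sums then counts each point
    once. *)
Lemma sum_ramp_quantile_le N : (0 < N)%N ->
  \sum_(k < N) \int[unif01]_u `|ramp N k (X u) - ramp N k (Y u)| <=
  \sum_(k < N) `|ramp_moment N mu k - ramp_moment N nu k| + Q%:R * (L / N%:R).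
Proof.
move=> N0n; have N0 : 0 < N%:R :> R by rewrite ltr0n.
have LN : 0 <= L / N%:R by rewrite divr_ge0.
have [x [x0 xQ xinc Gpos Gneg]] := signG.
pose c (k : nat) (q : 'I_Q) := (k%:R < N%:R * x q.+1 < k.+1%:R)%R%:R : R.
have c0 k q : 0 <= c k q by rewrite ler0n.
apply: (@le_trans _ _ (\sum_(k < N) (`|ramp_moment N mu k - ramp_moment N nu k| +
    \sum_(q < Q) c k q * (L / N%:R)))); last first.
  rewrite big_split/= lerD2l exchange_big/=.
  have -> : Q%:R * (L / N%:R) = \sum_(q < Q) L / N%:R.
    by rewrite sumr_const card_ord mulr_natl.
  apply: ler_sum => q _; rewrite -mulr_suml ler_piMl//.
  exact: sum_open_cells_le1.
apply: ler_sum => k _.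
have S0 : 0 <= \sum_(q < Q) c k q * (L / N%:R).
  by apply: sumr_ge0 => q _; rewrite mulr_ge0.
have kN := ltn_ord k.
case: (sign_on_cell kN x0 xQ Gpos) => [H|H|[q xq]].
- rewrite Rintegral_ramp_quantile_le ?lerDl//; left => y /H.
  by rewrite /G subr_le0.
- rewrite Rintegral_ramp_quantile_le ?lerDl//; right => y /H.
  by rewrite /G subr_ge0.
(* Only the term of the point [q] is kept on the right; the moment gap and the other points are
   dropped as nonnegative. *)
rewrite ler_wpDl// (bigD1 q)//= ler_wpDr//.
  by apply: sumr_ge0 => q' _; rewrite mulr_ge0.
rewrite /c xq mul1r; apply: Rintegral_ramp_gap_le => // y yk.
have q1 : (1 <= q.+1 <= Q)%N by rewrite /= ltn_ord.
(* The point belongs to both adjacent intervals, so the sign condition applied to it twice makes the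
   square of [G] nonpositive. *)
have Gq0 : G (x q.+1) = 0.
  have xqq : x q <= x q.+1 by apply/ltW/xinc; rewrite ltnW.
  have xqq' : x q.+1 <= x q.+2 by apply/ltW/xinc.
  have := Gneg q.+1 q1 (x q.+1) (x q.+1).
  rewrite /= !lexx xqq xqq' => /(_ isT isT) h.
  by apply/eqP; rewrite -sqrf_eq0 eq_le sqr_ge0 andbT expr2.
have y0 : 0 <= y by case/andP: yk => + _; apply: le_trans; rewrite divr_ge0.
have y1 : y <= 1.
  by case/andP: yk => _ /ltW/le_trans; apply; rewrite ler_pdivrMr// mul1r ler_nat.
have xq0 : 0 <= x q.+1.
  by rewrite -(ler_pM2l N0) mulr0; case/andP: xq => /ltW h _; exact: le_trans h.
have xq1 : x q.+1 <= 1.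
  rewrite -(ler_pM2l N0) mulr1; case/andP: xq => _ /ltW/le_trans; apply.
  by rewrite ler_nat.
have dist : `|y - x q.+1| <= N%:R^-1.
  have e : N%:R * `|y - x q.+1| = `|N%:R * y - N%:R * x q.+1|.
    by rewrite -mulrBr normrM gtr0_norm.
  rewrite -(ler_pM2l N0) mulfV ?gt_eqF// e ler_norml.
  by move: yk xq; rewrite ler_pdivrMr// ltr_pdivlMr// [y * _]mulrC -natr1; lra.
rewrite -/(G y) -[G y]subr0 -Gq0.
apply: (@le_trans _ _ (L * `|y - x q.+1|)); last by rewrite ler_wpM2l.
have [xy|/ltW yx] := leP (x q.+1) y.
  by rewrite [`|y - _|]ger0_norm ?subr_ge0// GL.
by rewrite distrC [`|y - _|]distrC [`|x q.+1 - _|]ger0_norm ?subr_ge0// GL.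
Qed.

End sign_changes.

Unset Implicit Arguments.
Set Strict Implicit.
Set Printing Implicit Defensive.

Theorem corollary5p8 (R : realType)
    (mu nu : probability (measurableTypeR R) R)
    (mu01 : mu (unit_itv R) = 1%E) (nu01 : nu (unit_itv R) = 1%E)
    (mu_ac : mu `<< lebesgue_measure) (nu_ac : nu `<< lebesgue_measure)
    (rho_mu rho_nu : measurableTypeR R -> R)
    (rho_muP : is_density mu rho_mu) (rho_nuP : is_density nu rho_nu) :
  (forall N : nat, (0 < N)%N ->
     exists2 pi, moment_problem mu nu N pi & transport_cost pi = I_ mu nu N) /\
  (forall Q : nat,
     changes_sign_at_most Q (fun x => cdf_of mu x - cdf_of nu x) ->
     finite_norm (lebesgue01 R) +oo%E (rho_mu \- rho_nu) ->
     forall N : nat, (0 < N)%N ->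
       (I_ mu nu N <= W1 mu nu)%E /\
       (W1 mu nu <= I_ mu nu N
          + 2%:E * 'N[lebesgue01 R]_+oo[EFin \o (rho_mu \- rho_nu)%R]
            * (Q%:R / N%:R ^+ 2)%:E)%E).
Proof.
split=> [N N0|Q signG fin_rho N N0].
  have [pi mpi cpi] := moment_problem_minimizer mu01 nu01 N0.
  by exists pi; rewrite // (I_moment_value mu01 nu01 N0).
split; first exact: I_le_W1.
apply: (le_trans (W1_le mu01 nu01 N0)).
rewrite (I_moment_value mu01 nu01 N0) -(density_gapE fin_rho) -!EFinM -EFinD lee_fin.
have L0 := density_gap_ge0 rho_mu rho_nu.
have GL := cdf_lipschitz rho_muP rho_nuP fin_rho.
have H := sum_ramp_quantile_le mu01 nu01 L0 GL signG N0.
have N0' : 0 < N%:R :> R by rewrite ltr0n.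
have Ni0 : 0 <= N%:R^-1 :> R by rewrite invr_ge0 ltW.
apply: (le_trans (ler_wpM2l Ni0 H)); rewrite mulrDr lerD2l.
set L := density_gap _ _ in L0 *.
(* One factor 1/N comes from the cost formula and the other from the width of the cell on which [G]
   is estimated. *)
have -> : N%:R^-1 * (Q%:R * (L / N%:R)) = L * (Q%:R / N%:R ^+ 2).
  by field; rewrite gt_eqF.
(* The estimate holds with constant 1; nonnegativity of the error term gives the stated constant
   2. *)
have : 0 <= L * (Q%:R / N%:R ^+ 2) by rewrite mulr_ge0// divr_ge0// exprn_ge0.
by rewrite -mulrA; lra.
Qed.
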